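(* Let $0<\eta<1/2$ and $0\le\delta<1/2$. Let $p_0>p_1>p_2\geq\ldots\geq p_N$ be real numbers in $[\eta,1-\eta]$ with $p_0-p_1=p_1-p_2$, put $\Delta_i=p_0-p_i$, and define $\mathbf{p}^0,\ldots,\mathbf{p}^N\in[0,1]^N$ by $\mathbf{p}^0_i=p_i$, and for $j\geq1$, $\mathbf{p}^j_i=p_i$ ($i\ne j$), $\mathbf{p}^j_j=p_0$. Let $M$ be such that $Mp_i$ is an integer for all $0\le i\le N$. For $k\in\{0,\ldots,N\}$ let $r(k)$ be a random reward function drawn uniformly among all $r:\{1,\ldots,N\}\times\{1,\ldots,M\}\to\{0,1\}$ with $M^{-1}\sum_{\omega}r_i(\omega)=\mathbf{p}^k_i$ for all $i$. Consider any quantum algorithm which, given access to the oracle $O^{r(k)}$ for an unknown $k$, makes $T$ oracle calls and outputs the best arm of $\mathbf{p}^k$ (arm $1$ if $k=0$, arm $k$ if $k\ge1$) with probability at least $1-\delta$ (over the randomness of $r(k)$ and of the measurement) for every $k\in\{0,\ldots,N\}$. Then $$T\geq\frac12\,\eta\,\bigl(1-2\sqrt{\delta(1-\delta)}\bigr)\left(\sum_{i=2}^N\Delta_i^{-2}\right)^{1/2}\geq c(\delta,\eta)\sqrt{H(\mathbf{p}^1)}.$$ This holds even though it is known to the algorithm that the mean reward vector lies in $\{\mathbf{p}^0,\ldots,\mathbf{p}^N\}$.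
   Context: Let $\mathcal{H}_A$ have orthonormal basis $\ket{1},\ldots,\ket{N}$ (arms), $\mathcal{H}_P$ have orthonormal basis $\ket{1},\ldots,\ket{M}$ (internal randomness), and $\mathcal{H}_R$ be a qubit. For $r:\{1..N\}\times\{1..M\}\to\{0,1\}$, $(i,\omega)\mapsto r_i(\omega)$, the oracle $O^r$ is the unitary on $\mathcal{H}_A\otimes\mathcal{H}_P\otimes\mathcal{H}_R$ with $O^r\ket{i}\ket{\omega}\ket{c}=\ket{i}\ket{\omega}\ket{c+r_i(\omega)\bmod 2}$. An algorithm with $T$ calls starts from a fixed state on $\mathcal{H}_A\otimes\mathcal{H}_P\otimes\mathcal{H}_R\otimes\mathcal{W}$ ($\mathcal{W}$ a workspace), alternately applies arbitrary unitaries and $O^r\otimes\mathrm{Id}_{\mathcal{W}}$ ($T$ times), and then measures a POVM whose outcome is the output arm. For $\mathbf{q}$ with unique largest entry $q_{i^*}$, $H(\mathbf{q})=\sum_{i\ne i^*}(q_{i^*}-q_i)^{-2}$; $c(\delta,\eta)>0$ denotes a constant depending only on $\delta,\eta$. *)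

(* Defs.v *)
From HB Require Import structures.
From mathcomp Require Import all_boot all_order all_algebra.
From mathcomp Require Import reals.
From mathcomp Require Import complex.
Set Implicit Arguments. Unset Strict Implicit. Unset Printing Implicit Defensive.
Import Order.TTheory GRing.Theory Num.Theory.
Local Open Scope ring_scope.
Local Open Scope complex_scope.

(* Basis index of H_A (x) H_P (x) H_R (x) W : arm i (0-based, i.e. arm i+1),
   randomness omega, reward qubit c, workspace basis index e. *)
Definition Idx (N M d : nat) : finType := ('I_N * 'I_M * bool * 'I_d)%type.

Definition reward (N M : nat) : finType := {ffun 'I_N * 'I_M -> bool}.

Section Q.
Variables (R : realType) (N M d : nat).
Local Notation C := R[i].
Local Notation I := (Idx N M d).

Definition apply_op (A : I -> I -> C) (v : I -> C) : I -> C :=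
  fun x => \sum_(y : I) A x y * v y.

Definition unitary (U : I -> I -> C) : Prop :=
  forall x y : I, \sum_(z : I) (U z x)^* * U z y = (x == y)%:R.

Definition quad (A : I -> I -> C) (v : I -> C) : C :=
  \sum_(x : I) \sum_(y : I) (v x)^* * A x y * v y.

Definition psd (A : I -> I -> C) : Prop :=
  forall v : I -> C, complex.Im (quad A v) = 0 /\ 0 <= complex.Re (quad A v).

(* O^r |i>|w>|c>|e> = |i>|w>|c + r_i(w) mod 2>|e> *)
Definition oracle (r : reward N M) (v : I -> C) : I -> C :=
  fun x => match x with (i, w, c, e) => v (i, w, addb c (r (i, w)), e) end.

Record algorithm := Algo {
  psi0 : I -> C;
  U : nat -> I -> I -> C;
  E : 'I_N -> I -> I -> C        (* POVM; outcome a : 'I_N is arm a+1 *)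
}.

Definition valid_algorithm (T : nat) (A : algorithm) : Prop :=
  [/\ \sum_(x : I) (psi0 A x)^* * psi0 A x = 1,
      forall t, (t <= T)%N -> unitary (U A t),
      forall a, psd (E A a) &
      forall x y : I, \sum_(a < N) E A a x y = (x == y)%:R].

Fixpoint state (A : algorithm) (r : reward N M) (t : nat) : I -> C :=
  match t with
  | 0 => apply_op (U A 0) (psi0 A)
  | t'.+1 => apply_op (U A t) (oracle r (state A r t'))
  end.

Definition prob_out (T : nat) (A : algorithm) (r : reward N M) (a : 'I_N) : R :=
  complex.Re (quad (E A a) (state A r T)).

Definition rewards_with_means (q : 'I_N -> R) : {set reward N M} :=
  [set r : reward N M | [forall i : 'I_N,
     (\sum_(w < M) ((r (i, w) : nat)%:R : R)) / M%:R == q i]].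

Definition succ_prob (T : nat) (A : algorithm) (q : 'I_N -> R) (a : 'I_N) : R :=
  (\sum_(r in rewards_with_means q) prob_out T A r a) / (#|rewards_with_means q|%:R).

End Q.

(* p : nat -> R, only p 0, ..., p N matter.  p^k : arms 'I_N (index i = arm i+1):
   p^k_{i+1} = p_{i+1} unless k = i+1, in which case it is p_0. *)
Definition pvec (R : realType) (N : nat) (p : nat -> R) (k : nat) : 'I_N -> R :=
  fun i => if k == i.+1 then p 0%N else p i.+1.

(* H(q) = sum_{i <> i*} (q_{i*} - q_i)^{-2} where i* is the unique largest entry
   (set to 0 when there is no unique largest entry; not used in that case). *)
Definition Hcomp (R : realType) (n : nat) (q : 'I_n -> R) : R :=
  match [pick i | [forall j, (j != i) ==> (q j < q i)]] with
  | Some i => \sum_(j | j != i) (q i - q j)^-2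
  | None => 0
  end.

(* Main.v *)
Require Import Defs.
From HB Require Import structures.
From mathcomp Require Import all_boot all_order all_algebra.
From mathcomp Require Import reals.
From mathcomp Require Import complex.
From mathcomp Require Import ring lra.

(* The adversary method.  For an arm [k >= 2], draw [r] from the rewards with
   means [p^0] and flip a uniform set [S] of [M Delta_k] zeros of its row [k]:
   the result [r'] is uniform among the rewards with means [p^k].  Let [psi_t]
   and [psi'_t] be the states under [r] and [r'].  The averaged overlap
   [E Re <psi_t, psi'_t>] starts at [1] and must end below
   [2 sqrt (delta (1 - delta))], since the two cases have different best arms.
   A single oracle call changes the overlap by at most
   [lambda ||P psi||^2 + ||P psi'||^2 / lambda], where [P] projects on arm [k]
   and randomness in [S].  Given [r], a zero lies in [S] with probability
   [Delta_k / (1 - p_k)], and given [r'], a one lies in [S] with probability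
   [Delta_k / p_0]; both are at most [Delta_k / eta].  So the average change is
   at most [Delta_k / eta (lambda m_k + 1 / lambda)], where [m_k] is the average
   weight of [psi] on arm [k].  Taking [lambda = Delta_k s] with
   [s = (sum_k Delta_k^-2)^(1/2)], weighting by [Delta_k^-2] and summing over
   [k] with [sum_k m_k <= 1] gives [s^2 (1 - 2 sqrt ...) <= 2 T s / eta].
   Finally [H (p^1) = s^2], so the second inequality is an equality. *)
Set Implicit Arguments. Unset Strict Implicit. Unset Printing Implicit Defensive.
Import Order.TTheory GRing.Theory Num.Theory.
Local Open Scope ring_scope.

(** * Overlaps and weights of complex vectors *)

Section InnerProduct.
Local Open Scope complex_scope.
Local Open Scope ring_scope.
Variables (R : realType) (J : finType).
Implicit Types (v w : J -> R[i]) (B : J -> J -> R[i]).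

(** The Euclidean inner product of the underlying real space, hence symmetric. *)
Definition rdot v w : R := complex.Re (\sum_x (v x)^* * w x).

(** Squared norm of the orthogonal projection of [v] on the basis vectors in [P]. *)
Definition massOn (P : pred J) v : R :=
  \sum_(x | P x) (complex.Re (v x) ^+ 2 + complex.Im (v x) ^+ 2).

Lemma ReD (a b : R[i]) : complex.Re (a + b) = complex.Re a + complex.Re b.
Proof. by case: a b => [? ?] [? ?]. Qed.

Lemma Re_sum (K : finType) (P : pred K) (F : K -> R[i]) :
  complex.Re (\sum_(x | P x) F x) = \sum_(x | P x) complex.Re (F x).
Proof. by apply: (big_morph _ ReD). Qed.

Lemma Re_conjM (a b : R[i]) :
  complex.Re (a^* * b) =
  complex.Re a * complex.Re b + complex.Im a * complex.Im b.
Proof. by case: a b => [? ?] [? ?] /=; rewrite mulNr opprK. Qed.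

Lemma rdotE v w : rdot v w =
  \sum_x (complex.Re (v x) * complex.Re (w x) +
          complex.Im (v x) * complex.Im (w x)).
Proof. by rewrite /rdot Re_sum; apply: eq_bigr => x _; rewrite Re_conjM. Qed.

Lemma rdotC v w : rdot v w = rdot w v.
Proof. by rewrite !rdotE; apply: eq_bigr => x _; ring. Qed.

Lemma massOn_ge0 P v : 0 <= massOn P v.
Proof. by apply: sumr_ge0 => x _; rewrite addr_ge0 ?sqr_ge0. Qed.

Lemma massOn_le P v : massOn P v <= rdot v v.
Proof.
rewrite rdotE (bigID P) /= -[leLHS]addr0; apply: lerD.
  by apply: ler_sum => x _; rewrite !expr2.
by apply: sumr_ge0 => x _; rewrite -!expr2 addr_ge0 ?sqr_ge0.
Qed.

Definition sesq B v w : R[i] := \sum_x \sum_y (v x)^* * B x y * w y.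

(* Positivity of the form at [mu v - w] replaces the Cauchy-Schwarz inequality
   for [B], and only involves the symmetrised cross term, so that [B] need not
   be shown Hermitian. *)
Lemma quad_comb B (a b : R) v w :
  let f u := \sum_x \sum_y (u x)^* * B x y * u y in
  f (fun x => a%:C * v x + b%:C * w x) =
  (a ^+ 2)%:C * f v + (b ^+ 2)%:C * f w +
  (a * b)%:C * (sesq B v w + sesq B w v).
Proof.
rewrite /= mulrDr !mulr_sumr -!big_split /=; apply: eq_bigr => x _.
rewrite !mulr_sumr -!big_split /=; apply: eq_bigr => y _.
have -> : (a%:C * v x + b%:C * w x)^* = a%:C * (v x)^* + b%:C * (w x)^*.
  by rewrite rmorphD !rmorphM; congr (_ * _ + _ * _); exact: conjc_real.
rewrite rmorphXn rmorphXn rmorphM /=; ring.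
Qed.

End InnerProduct.

(** * Effect of unitaries, oracle calls and the measurement on the overlap *)

Section Evolution.
Local Open Scope complex_scope.
Local Open Scope ring_scope.
Variables (R : realType) (N M d : nat).
Local Notation I := (Idx N M d).
Implicit Types (v w : I -> R[i]) (r : reward N M).

Lemma rdot_unitary (U : I -> I -> R[i]) v w :
  unitary U -> rdot (apply_op U v) (apply_op U w) = rdot v w.
Proof.
move=> unU; rewrite /rdot /apply_op; congr complex.Re.
transitivity (\sum_x \sum_y (v x)^* * w y * \sum_z (U z x)^* * U z y).
  transitivity (\sum_z \sum_x \sum_y (v x)^* * w y * ((U z x)^* * U z y)).
    apply: eq_bigr => z _; rewrite rmorph_sum mulr_suml; apply: eq_bigr => x _.
    by rewrite mulr_sumr; apply: eq_bigr => y _; rewrite rmorphM /=; ring.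
  rewrite exchange_big; apply: eq_bigr => x _; rewrite exchange_big /=.
  by apply: eq_bigr => y _; rewrite mulr_sumr.
apply: eq_bigr => x _; rewrite (bigD1 x) //= unU eqxx mulr1 big1 ?addr0 //.
by move=> y yx; rewrite unU eq_sym (negPf yx) mulr0.
Qed.

(** The permutation of the basis underlying the oracle; being an involution, it can be used to
    reindex sums. *)
Definition flipc r (x : I) : I := (x.1.1, addb x.1.2 (r x.1.1), x.2).

Lemma flipcK r : involutive (flipc r).
Proof. by move=> [[[i w] c] e]; rewrite /flipc /= addbK. Qed.

Lemma oracleE r v x : oracle r v x = v (flipc r x).
Proof. by case: x => [[[i w] c] e]. Qed.

Lemma rdot_oracle r v w : rdot (oracle r v) (oracle r w) = rdot v w.
Proof.
rewrite !rdotE [RHS](reindex_inj (inv_inj (flipcK r))) /=.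
by apply: eq_bigr => x _; rewrite !oracleE.
Qed.

Definition differ r r' (x : I) : bool := r x.1.1 != r' x.1.1.

(* On the indices where the oracles differ, conjugating one by the other flips
   the reward qubit; each of the two cross terms is bounded by AM-GM. *)
Lemma rdot_oracle_diff r r' v w (lam : R) : 0 < lam ->
  rdot v w - rdot (oracle r v) (oracle r' w) <=
  lam * massOn (differ r r') v + lam^-1 * massOn (differ r r') w.
Proof.
move=> lam0; set D := differ r r'.
pose h (x : I) : I := (x.1.1, ~~ x.1.2, x.2).
have hK : involutive h by case=> [[a c] e]; rewrite /h /= negbK.
(* [D] does not see the reward qubit, so its weight is invariant under [h]. After this
   symmetrisation the inequality holds index by index. *)
have -> : massOn D w = (massOn D w + massOn D (w \o h)) / 2.
  suff -> : massOn D (w \o h) = massOn D w by field.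
  by rewrite /massOn [RHS](reindex_inj (inv_inj hK)).
have -> : rdot (oracle r v) (oracle r' w) =
    rdot v (fun x => w (flipc r' (flipc r x))).
  rewrite !rdotE [LHS](reindex_inj (inv_inj (flipcK r))).
  by apply: eq_bigr => x _; rewrite !oracleE flipcK.
rewrite !rdotE -sumrB.
rewrite (bigID D) /= [X in _ + X]big1 => [|x].
  rewrite addr0 /massOn -big_split /= mulr_suml !mulr_sumr -big_split /=.
  apply: ler_sum => x Dx.
  have -> : flipc r' (flipc r x) = h x.
    case: x Dx => [[[i a] c] e]; rewrite /D /differ /flipc /h /=.
    by case: (r _) (r' _) c => [] [] // [].
  have amgm (s a b : R) : `|s| = 1 ->
      s * (a * b) <= (lam * a ^+ 2 + lam^-1 * b ^+ 2) / 2.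
    move=> s1; have := sqr_ge0 (lam * a - s * b).
    rewrite -(pmulr_rge0 _ (_ : 0 < lam^-1)) ?invr_gt0 //.
    have -> : lam^-1 * (lam * a - s * b) ^+ 2 =
        lam * a ^+ 2 + lam^-1 * (`|s| ^+ 2 * b ^+ 2) - 2 * (s * (a * b)).
      by rewrite real_normK ?num_real //; field; rewrite gt_eqF.
    by rewrite s1 expr1n; lra.
  have n1 : `|1 : R| = 1 by rewrite normr1.
  have n2 : `|- 1 : R| = 1 by rewrite normrN1.
  have := amgm 1 (complex.Re (v x)) (complex.Re (w x)) n1.
  have := amgm 1 (complex.Im (v x)) (complex.Im (w x)) n1.
  have := amgm (-1) (complex.Re (v x)) (complex.Re (w (h x))) n2.
  have := amgm (-1) (complex.Im (v x)) (complex.Im (w (h x))) n2.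
  by rewrite /comp; lra.
rewrite /D /differ negbK => /eqP rr'.
by rewrite /flipc /= rr' addbK; case: x {rr'} => [[? ?] ?]; rewrite subrr.
Qed.

Lemma rdot_state T (A : algorithm R N M d) r t :
  valid_algorithm T A -> (t <= T)%N -> rdot (state A r t) (state A r t) = 1.
Proof.
move=> [psi1 unU _ _]; elim: t => [|t IHt] tT /=.
  by rewrite rdot_unitary; [rewrite /rdot psi1 | exact: unU].
rewrite rdot_unitary; last exact: unU.
by rewrite rdot_oracle IHt // ltnW.
Qed.

(* Ambainis's indistinguishability bound, in the linearised (AM-GM) form that
   can be averaged over pairs of reward functions. *)
Lemma rdot_povm T (A : algorithm R N M d) r r' (a b : 'I_N) (mu : R) :
  valid_algorithm T A -> a != b -> 0 < mu -> mu <= 1 ->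
  rdot (state A r T) (state A r' T) <=
  (mu + mu^-1 + (mu - mu^-1) *
     (prob_out T A r a + prob_out T A r' b - 1)) / 2.
Proof.
move=> vA ab mu0 mu1; have [_ _ psdE sumE] := vA.
have imu : mu * mu^-1 = 1 by rewrite mulfV // gt_eqF.
have mu_le : mu - mu^-1 <= 0 by rewrite subr_le0 (le_trans mu1) // invf_ge1.
set v := state A r T; set w := state A r' T.
pose q c u := complex.Re (quad (E A c) u).
pose X c := complex.Re (sesq (E A c) v w + sesq (E A c) w v).
have q0 c u : 0 <= q c u by case: (psdE c u).
have ReZ (s : R) z : complex.Re (s%:C * z) = s * complex.Re z.
  by case: z => ? ? /=; rewrite mul0r subr0.
have X_le c (s : R) : 0 < s -> X c <= s * q c v + s^-1 * q c w.
  move=> s0; have := q0 c (fun x => s%:C * v x + (-1)%:C * w x).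
  rewrite /q /quad quad_comb !ReD !ReZ -/(quad _ v) -/(quad _ w).
  rewrite -!/(q _ _) -/(X c) => h.
  have : 0 <= s^-1 * (s ^+ 2 * q c v + (-1) ^+ 2 * q c w + s * -1 * X c).
    by rewrite mulr_ge0 // invr_ge0 ltW.
  have -> : s^-1 * (s ^+ 2 * q c v + (-1) ^+ 2 * q c w + s * -1 * X c) =
      s * q c v + s^-1 * q c w - X c by field; rewrite gt_eqF.
  by rewrite subr_ge0.
have sesq_sum u u' : \sum_c complex.Re (sesq (E A c) u u') = rdot u u'.
  rewrite -Re_sum /rdot; congr complex.Re.
  rewrite /sesq exchange_big; apply: eq_bigr => x _; rewrite exchange_big /=.
  under eq_bigr do rewrite -mulr_suml -mulr_sumr sumE.
  rewrite (bigD1 x) //= eqxx mulr1 big1 ?addr0 // => y yx.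
  by rewrite eq_sym (negPf yx) mulr0 mul0r.
have qsum r0 : \sum_c q c (state A r0 T) = 1.
  by rewrite sesq_sum (rdot_state _ vA).
have Xsum : \sum_c X c = 2 * rdot v w.
  rewrite /X; under eq_bigr do rewrite ReD.
  by rewrite big_split /= !sesq_sum [rdot w v]rdotC; ring.
have qv := qsum r; have qw := qsum r'; rewrite -/v -/w in qv qw.
rewrite (bigD1 a) //= in qv; rewrite (bigD1 a) //= in qw.
have qwb : q b w <= \sum_(c | c != a) q c w.
  by rewrite (bigD1 b) 1?eq_sym //= lerDl sumr_ge0.
(* Outcome [a] should be likely under [r] and rare under [r']. So it gets the factor [mu <= 1] on
   the [r] side and [mu^-1] on the [r'] side; all other outcomes get the opposite weights. *)
have : \sum_(c | c != a) X c <=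
    mu^-1 * (\sum_(c | c != a) q c v) + mu * (\sum_(c | c != a) q c w).
  rewrite !mulr_sumr -big_split /=; apply: ler_sum => c _.
  by have := X_le c mu^-1; rewrite invrK invr_gt0; apply.
have := X_le a mu mu0; move: Xsum; rewrite (bigD1 a) //=.
rewrite /prob_out -/v -/w -/(q a v) -/(q b w).
have -> : \sum_(c | c != a) q c v = 1 - q a v by rewrite -qv; ring.
have eqw : q a w = 1 - \sum_(c | c != a) q c w by rewrite -qw; ring.
rewrite eqw; set Q := (\sum_(c | c != a) q c w) in qwb *.
set Y := \sum_(c | c != a) X c => XY Xa Ya.
have : (mu - mu^-1) * Q <= (mu - mu^-1) * q b w by rewrite ler_wnM2l.
move: Ya Xa; rewrite !mulrBr !mulrBl !mulrDr; lra.
Qed.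

End Evolution.

(** * Counting rewards and the sets of flipped bits *)

Section RandomRewards.
Variables (R : realType) (N M : nat).
Implicit Types (r : reward N M) (k : 'I_N) (q : 'I_N -> R) (S B : {set 'I_M}).

Definition ones r k : {set 'I_M} := [set w | r (k, w)].

Definition flip k S r : reward N M :=
  [ffun x => addb (r x) ((x.1 == k) && (x.2 \in S))].

Lemma flipK k S : involutive (flip k S).
Proof. by move=> r; apply/ffunP => x; rewrite !ffunE addbK. Qed.

Lemma ones_flip k S r i :
  ones (flip k S r) i = if i == k then (ones r k :\: S) :|: (S :\: ones r k)
                        else ones r i.
Proof.
apply/setP => w; case: eqP => [->|/eqP/negPf ik]; rewrite !inE !ffunE /=.
  by rewrite eqxx /=; case: (w \in S) (r _) => [] [].
by rewrite ik addbF.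
Qed.

Lemma mem_rewards q r : (0 < M)%N ->
  (r \in rewards_with_means M q) = [forall i, #|ones r i|%:R == M%:R * q i].
Proof.
move=> M0; rewrite inE; apply: eq_forallb => i.
have -> : \sum_(w < M) ((r (i, w) : nat)%:R : R) = #|ones r i|%:R.
  rewrite -sum1_card natr_sum [RHS]big_mkcond /=; apply: eq_bigr => w _.
  by rewrite inE; case: (r _).
have M0' : M%:R != 0 :> R by rewrite pnatr_eq0 -lt0n.
by apply/eqP/eqP => [<-|->]; field.
Qed.

(** Flipping [m] zeros of row [k] turns them into ones and leaves the other rows alone. The
    equivalence lets a sum over pairs [(r, S)] be reindexed by the other endpoint [flip k S r]. *)
Lemma flip_rewards q q' k (m : nat) r S : (0 < M)%N ->
  (forall i, i != k -> q' i = q i) -> M%:R * q' k = M%:R * q k + m%:R ->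
  [&& r \in rewards_with_means M q, S \subset ~: ones r k & #|S| == m] =
  [&& flip k S r \in rewards_with_means M q', S \subset ones (flip k S r) k
   & #|S| == m].
Proof.
move=> M0 qE qk; rewrite !mem_rewards // ones_flip eqxx.
have subE : (S \subset ~: ones r k) =
    (S \subset (ones r k :\: S) :|: (S :\: ones r k)).
  apply/subsetP/subsetP => sub w wS; have := sub w wS; rewrite !inE wS /=.
    by rewrite andbT.
  by rewrite andbT.
rewrite -subE; have [sub|] := boolP (S \subset ~: ones r k); last by rewrite !andbF.
have [/eqP Sm|] := boolP (#|S| == m); last by rewrite !andbF.
rewrite /= !andbT; apply: eq_forallb => i; rewrite ones_flip.
have [->|/qE -> //] := eqVneq i k.
have dis : [disjoint ones r k & S].
  by rewrite disjoint_sym disjoints_subset.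
move: (dis); rewrite -setI_eq0 => /eqP dis0.
have -> : (ones r k :\: S) :|: (S :\: ones r k) = ones r k :|: S.
  apply/setP => w; move/setP/(_ w): dis0; rewrite !inE.
  by case: (r _) (w \in S) => [] [].
by rewrite cardsU dis0 cards0 subn0 natrD Sm qk (inj_eq (addIr _)).
Qed.

Lemma card_ones q r k : (0 < M)%N -> r \in rewards_with_means M q ->
  #|ones r k|%:R = M%:R * q k.
Proof. by move=> M0; rewrite mem_rewards // => /forallP/(_ k)/eqP. Qed.

Lemma card_zeros q r k : (0 < M)%N -> r \in rewards_with_means M q ->
  #|~: ones r k|%:R = M%:R * (1 - q k).
Proof.
move=> M0 rq; rewrite mulrBr mulr1 -(card_ones k M0 rq); apply/eqP.
by rewrite eq_sym subr_eq -natrD addnC cardsC card_ord.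
Qed.

(** Removing [w] from [S] leaves an [(m-1)]-subset of [B :\ w], and
    [|B| C(|B|-1, m-1) = m C(|B|, m)]. So a point lies in at most a fraction [m / |B|] of the
    [m]-subsets of [B]. *)
Lemma card_subsets_with B (m : nat) (w : 'I_M) :
  (#|[set S : {set 'I_M} | [&& S \subset B, #|S| == m & w \in S]]| * #|B| <=
   m * 'C(#|B|, m))%N.
Proof.
have [wB|wNB] := boolP (w \in B); last first.
  rewrite [X in (#|pred_of_set X| * _)%N](_ : _ = set0) ?cards0 //.
  apply/setP => S; rewrite !inE; apply/negbTE; apply: contra wNB.
  by case/and3P=> /subsetP sub _ /sub.
case: m => [|m].
  rewrite [X in (#|pred_of_set X| * _)%N](_ : _ = set0) ?cards0 //.
  by apply/setP => S; rewrite !inE cards_eq0; case: eqP => [->|];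
    rewrite ?inE ?andbF.
rewrite -mul_bin_diag mulnC leq_mul2l; apply/orP; right.
have -> : (#|B|.-1 = #|B :\ w|)%N by rewrite (cardsD1 w B) wB.
rewrite -cards_draws.
apply: leq_trans (leq_imset_card (fun S => w |: S) _).
apply/subset_leq_card/subsetP => S; rewrite inE => /and3P[SB /eqP Sm wS].
apply/imsetP; exists (S :\ w); last by rewrite setD1K.
by rewrite inE setSD //=; rewrite -eqSS -Sm (cardsD1 w S) wS.
Qed.

End RandomRewards.

(** * The adversary inequality for a single arm *)

Section ArmBound.
Variables (R : realType) (N M d : nat).
Local Notation I := (Idx N M d).
Implicit Types (r : reward N M) (v : I -> R[i]) (B S : {set 'I_M}) (k : 'I_N).

Definition on_arm k (x : I) : bool := x.1.1.1 == k.

Lemma differ_flip k S r x :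
  @differ N M d r (flip k S r) x = on_arm k x && (x.1.1.2 \in S).
Proof.
by rewrite /differ ffunE /on_arm; case: (_ && _); case: (r _).
Qed.

(** After exchanging the sums, each basis index on arm [k] is counted once per [S] containing its
    randomness, that is, for at most a fraction [beta] of the sets. *)
Lemma massOn_subsets k B (m : nat) v (beta : R) :
  (0 < #|B|)%N -> m%:R <= beta * #|B|%:R ->
  \sum_(S : {set 'I_M} | (S \subset B) && (#|S| == m))
     massOn (fun x : I => on_arm k x && (x.1.1.2 \in S)) v <=
  beta * 'C(#|B|, m)%:R * massOn (on_arm k) v.
Proof.
move=> B0 mB; rewrite /massOn mulr_sumr.
have -> : \sum_(S : {set 'I_M} | (S \subset B) && (#|S| == m))
    \sum_(x : I | on_arm k x && (x.1.1.2 \in S))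
       (complex.Re (v x) ^+ 2 + complex.Im (v x) ^+ 2) =
  \sum_(x : I | on_arm k x)
     #|[set S : {set 'I_M} | [&& S \subset B, #|S| == m & x.1.1.2 \in S]]|%:R *
     (complex.Re (v x) ^+ 2 + complex.Im (v x) ^+ 2).
  rewrite (exchange_big_dep (on_arm k)) /=; last by move=> S x _ /andP[].
  apply: eq_bigr => x kx; rewrite -sum1_card natr_sum mulr_suml.
  apply: eq_big => S; last by rewrite mul1r.
  by rewrite inE kx /= -andbA.
apply: ler_sum => x _; rewrite ler_wpM2r ?addr_ge0 ?sqr_ge0 //.
have B0' : 0 < #|B|%:R :> R by rewrite ltr0n.
rewrite -(ler_pM2r B0') -natrM.
apply: le_trans (_ : (m * 'C(#|B|, m))%:R <= _).
  by rewrite ler_nat card_subsets_with.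
by rewrite natrM mulrAC ler_wpM2r.
Qed.

(** Expectation over a uniform reward function; [succ_prob] unfolds to an instance. *)
Definition avg (q : 'I_N -> R) (f : reward N M -> R) : R :=
  (\sum_(r in rewards_with_means M q) f r) / #|rewards_with_means M q|%:R.

Lemma sum_avg q f : (0 < #|rewards_with_means M q|)%N ->
  \sum_(r in rewards_with_means M q) f r =
  #|rewards_with_means M q|%:R * avg q f.
Proof. by move=> h; rewrite mulrC divfK // pnatr_eq0 -lt0n. Qed.

(* The pairs [(r, flip k S r)], with [S] a set of [m] zeros of row [k] of [r],
   form a biregular bipartite graph, so that a uniform edge has uniform
   endpoints. *)
Lemma arm_bound T (A : algorithm R N M d) (q q' : 'I_N -> R) (k a : 'I_N)
    (m : nat) (beta lam mu : R) :
  valid_algorithm T A -> a != k -> (0 < M)%N ->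
  (forall i, i != k -> q' i = q i) -> M%:R * q' k = M%:R * q k + m%:R ->
  (0 < #|rewards_with_means M q|)%N -> (0 < #|rewards_with_means M q'|)%N ->
  q' k <= 1 -> q k < 1 -> 0 < q' k ->
  m%:R <= beta * (M%:R * (1 - q k)) -> m%:R <= beta * (M%:R * q' k) ->
  0 < lam -> 0 < mu -> mu <= 1 ->
  1 <= (mu + mu^-1 + (mu - mu^-1) *
         (succ_prob T A q a + succ_prob T A q' k - 1)) / 2 +
       beta * \sum_(t < T)
         (lam * avg q (fun r => massOn (on_arm k) (state A r t)) + lam^-1).
Proof.
move=> vA ak M0 qE qk Rq0 Rq'0 q'1 q1 q'0 mq mq' lam0 mu0 mu1.
pose Rq := rewards_with_means M q; pose Rq' := rewards_with_means M q'.
pose P (r : reward N M) S := (S \subset ~: ones r k) && (#|S| == m).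
pose P' (r : reward N M) S := (S \subset ones r k) && (#|S| == m).
have M0' : 0 < M%:R :> R by rewrite ltr0n.
have flip_sum (F : reward N M -> {set 'I_M} -> R) :
    \sum_(r in Rq) \sum_(S | P r S) F (flip k S r) S =
    \sum_(r in Rq') \sum_(S | P' r S) F r S.
  rewrite !pair_big_dep /=.
  have invf : involutive (fun u : reward N M * {set 'I_M} =>
      (flip k u.2 u.1, u.2)) by case=> r S; rewrite /= flipK.
  rewrite [RHS](reindex_inj (inv_inj invf)) /=; apply: eq_bigl => -[r S] /=.
  exact: (flip_rewards r S M0 qE qk).
have [r1 r1q] : exists r, r \in Rq by apply/set0Pn; rewrite -card_gt0.
have [r2 r2q] : exists r, r \in Rq' by apply/set0Pn; rewrite -card_gt0.
(* The means fix the number of zeros and ones of row [k], so [z] and [o] do not depend on the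
   representatives [r1], [r2]. This makes the graph biregular. *)
pose z := #|~: ones r1 k|; pose o := #|ones r2 k|.
have zR : z%:R = M%:R * (1 - q k) by rewrite (card_zeros k M0 r1q).
have oR : o%:R = M%:R * q' k by rewrite (card_ones k M0 r2q).
have zE r : r \in Rq -> #|~: ones r k| = z.
  by move=> rq; apply/eqP; rewrite -(eqr_nat R) zR (card_zeros k M0 rq).
have oE r : r \in Rq' -> #|ones r k| = o.
  by move=> rq; apply/eqP; rewrite -(eqr_nat R) oR (card_ones k M0 rq).
have degP r : r \in Rq -> \sum_(S | P r S) (1 : R) = 'C(z, m)%:R.
  move=> rq; rewrite -(zE r rq) -cards_draws -sum1_card natr_sum.
  by apply: eq_bigl => S; rewrite inE.
have degP' r : r \in Rq' -> \sum_(S | P' r S) (1 : R) = 'C(o, m)%:R.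
  move=> rq; rewrite -(oE r rq) -cards_draws -sum1_card natr_sum.
  by apply: eq_bigl => S; rewrite inE.
have sumP (f : reward N M -> R) :
    \sum_(r in Rq) \sum_(S | P r S) f r = 'C(z, m)%:R * \sum_(r in Rq) f r.
  rewrite mulr_sumr; apply: eq_bigr => r rq; rewrite -(degP r rq) mulr_suml.
  by apply: eq_bigr => S _; rewrite mul1r.
have sumP' (f : reward N M -> R) :
    \sum_(r in Rq') \sum_(S | P' r S) f r = 'C(o, m)%:R * \sum_(r in Rq') f r.
  rewrite mulr_sumr; apply: eq_bigr => r rq; rewrite -(degP' r rq) mulr_suml.
  by apply: eq_bigr => S _; rewrite mul1r.
(* The number of edges, counted here from the [q] side and in [KE] from the [q'] side. *)
pose K : R := 'C(z, m)%:R * #|Rq|%:R.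
have KE : K = 'C(o, m)%:R * #|Rq'|%:R.
  have sum1 (Q : {set reward N M}) : \sum_(r in Q) (1 : R) = #|Q|%:R.
    by rewrite -sum1_card natr_sum.
  by rewrite /K -!sum1 -sumP -sumP'; apply: (flip_sum (fun _ _ => 1)).
have z0 : (0 < z)%N by rewrite -(ltr0n R) zR mulr_gt0 // subr_gt0.
have o0 : (0 < o)%N by rewrite -(ltr0n R) oR mulr_gt0.
have K0 : 0 < K.
  (* [m <= z] holds because [M q_k + m = M q'_k] is at most [M]. *)
  rewrite mulr_gt0 ?ltr0n // bin_gt0 -(ler_nat R) zR.
  have : M%:R * q' k <= M%:R by rewrite ler_piMr // ltW.
  by rewrite qk; lra.
pose F t : R := \sum_(r in Rq) \sum_(S | P r S)
   rdot (state A r t) (state A (flip k S r) t).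
have F0 : F 0%N = K.
  rewrite /F /K -sum1_card natr_sum -sumP.
  apply: eq_bigr => r _; apply: eq_bigr => S _ /=.
  exact: (rdot_state r vA (leq0n T)).
have Fstep t : (t < T)%N -> F t - F t.+1 <=
      K * (beta *
        (lam * avg q (fun r => massOn (on_arm k) (state A r t)) + lam^-1)).
  move=> tT; have [_ unU _ _] := vA.
  pose G (r : reward N M) S :=
    massOn (fun x : I => on_arm k x && (x.1.1.2 \in S)) (state A r t).
  have -> : F t - F t.+1 = \sum_(r in Rq) \sum_(S | P r S)
      (rdot (state A r t) (state A (flip k S r) t) -
       rdot (oracle r (state A r t))
            (oracle (flip k S r) (state A (flip k S r) t))).
    rewrite -sumrB; apply: eq_bigr => r _; rewrite -sumrB; apply: eq_bigr => S _.
    by congr (_ - _) => /=; rewrite rdot_unitary //; exact: unU.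
  apply: le_trans (_ : \sum_(r in Rq) \sum_(S | P r S)
      (lam * G r S + lam^-1 * G (flip k S r) S) <= _).
    apply: ler_sum => r _; apply: ler_sum => S _.
    apply: le_trans (rdot_oracle_diff _ _ _ _ lam0) _.
    by rewrite /massOn !(eq_bigl _ _ (differ_flip k S r)).
  (* The second weight is reindexed by the [q'] endpoint, for which [S] is a uniform set of ones
     rather than of zeros. *)
  have -> : \sum_(r in Rq) \sum_(S | P r S)
      (lam * G r S + lam^-1 * G (flip k S r) S) =
    lam * (\sum_(r in Rq) \sum_(S | P r S) G r S) +
    lam^-1 * (\sum_(r in Rq') \sum_(S | P' r S) G r S).
    rewrite -flip_sum !mulr_sumr -big_split /=; apply: eq_bigr => r _.
    by rewrite big_split /= !mulr_sumr.
  have G1 : \sum_(r in Rq) \sum_(S | P r S) G r S <=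
      K * beta * avg q (fun r => massOn (on_arm k) (state A r t)).
    have -> : K * beta * avg q (fun r => massOn (on_arm k) (state A r t)) =
       beta * 'C(z, m)%:R * \sum_(r in Rq) massOn (on_arm k) (state A r t).
      by rewrite sum_avg // /K -/Rq; ring.
    rewrite mulr_sumr; apply: ler_sum => r rq; rewrite -(zE r rq).
    by apply: massOn_subsets; rewrite (zE r rq) // zR.
  (* Here the weight on arm [k] is bounded by 1: [q'] varies with [k], so these weights have no
     useful sum over the arms. *)
  have G2 : \sum_(r in Rq') \sum_(S | P' r S) G r S <= K * beta.
    have -> : K * beta = \sum_(r in Rq') beta * 'C(o, m)%:R.
      by rewrite sumr_const KE -mulr_natr; ring.
    apply: ler_sum => r rq; rewrite -(oE r rq).
    apply: le_trans (_ : beta * 'C(#|ones r k|, m)%:R *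
        massOn (on_arm k) (state A r t) <= _).
      by apply: massOn_subsets; rewrite (oE r rq) // oR.
    rewrite ler_piMr ?mulr_ge0 //.
      (* [beta >= 0] is read off [mq'], since [m] is a natural number. *)
      rewrite -(pmulr_lge0 _ (_ : 0 < M%:R * q' k)) ?mulr_gt0 //.
      exact: le_trans mq'.
    by rewrite -(rdot_state r vA (ltnW tT)) massOn_le.
  have := ler_wpM2l (ltW lam0) G1.
  have := ler_wpM2l (ltW (_ : 0 < lam^-1)) G2; rewrite invr_gt0 => /(_ lam0).
  lra.
have Ftel : K - F T <= K * (beta * \sum_(t < T)
    (lam * avg q (fun r => massOn (on_arm k) (state A r t)) + lam^-1)).
  rewrite !mulr_sumr -F0 -opprB -(telescope_sumr _ (leq0n T)) -sumrN big_mkord.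
  apply: ler_sum => t _; rewrite opprB F0; exact: Fstep.
have FT : F T <= K * ((mu + mu^-1 + (mu - mu^-1) *
    (succ_prob T A q a + succ_prob T A q' k - 1)) / 2).
  have -> : K * ((mu + mu^-1 + (mu - mu^-1) *
      (succ_prob T A q a + succ_prob T A q' k - 1)) / 2) =
    \sum_(r in Rq) \sum_(S | P r S) ((mu + mu^-1 + (mu - mu^-1) *
      (prob_out T A r a + prob_out T A (flip k S r) k - 1)) / 2).
    have s0 : \sum_(r in Rq) \sum_(S | P r S) prob_out T A r a =
        K * succ_prob T A q a.
      by rewrite sumP sum_avg // mulrA.
    have s1 : \sum_(r in Rq) \sum_(S | P r S) prob_out T A (flip k S r) k =
        K * succ_prob T A q' k.
      rewrite (flip_sum (fun r _ => prob_out T A r k)) sumP' sum_avg //.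
      by rewrite KE mulrA.
    have s2 : \sum_(r in Rq) \sum_(S | P r S) (1 : R) = K.
      by rewrite sumP sumr_const.
    transitivity (((mu + mu^-1) / 2 - (mu - mu^-1) / 2) * K +
       (mu - mu^-1) / 2 * (K * succ_prob T A q a) +
       (mu - mu^-1) / 2 * (K * succ_prob T A q' k)); first by ring.
    rewrite -s0 -s1 -{1}s2 !mulr_sumr -!big_split /=; apply: eq_bigr => r _.
    rewrite !mulr_sumr -!big_split /=; apply: eq_bigr => S _; ring.
  apply: ler_sum => r _; apply: ler_sum => S _; exact: rdot_povm.
rewrite -(ler_pM2l K0) mulr1 mulrDr; lra.
Qed.

End ArmBound.

(** * Optimising [mu] and summing over the arms *)

Section Assembly.
Variable R : realType.

Lemma sum_massOn_arms N M d (v : Idx N M d -> R[i]) :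
  \sum_(k < N) massOn (on_arm k) v = rdot v v.
Proof.
by rewrite rdotE (partition_big (fun x : Idx N M d => x.1.1.1) xpredT).
Qed.

(* [mu = sqrt (delta / (1 - delta))] is optimal, but it is excluded when
   [delta = 0]. *)
Lemma le_2sqrt_of_forall (delta x : R) : 0 <= delta -> delta < 1 / 2 ->
  (forall mu, 0 < mu -> mu <= 1 -> x <= mu * (1 - delta) + delta / mu) ->
  x <= 2 * Num.sqrt (delta * (1 - delta)).
Proof.
move=> d0 d1 h; have [d_eq0|dN0] := eqVneq delta 0.
  rewrite d_eq0 mul0r sqrtr0 mulr0 leNgt; apply/negP => x0.
  (* For [delta = 0] the hypothesis reads [x <= mu]. Taking [mu = 1] makes [x / 2] an admissible
     value of [mu], which gives [x <= x / 2]. *)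
  have := h 1 ltr01 (lexx _); rewrite d_eq0 => x1.
  have := h (x / 2); rewrite d_eq0 divr_gt0 //.
  by move=> /(_ isT); lra.
have d0' : 0 < delta by rewrite lt_def dN0.
have d2 : 0 < 1 - delta by lra.
pose a := Num.sqrt delta; pose b := Num.sqrt (1 - delta).
have a0 : 0 < a by rewrite sqrtr_gt0.
have b0 : 0 < b by rewrite sqrtr_gt0.
have aa : delta = a ^+ 2 by rewrite sqr_sqrtr.
have bb : 1 - delta = b ^+ 2 by rewrite sqr_sqrtr // ltW.
have ab : a <= b by rewrite ler_wsqrtr //; lra.
have := h (a / b); rewrite divr_gt0 // ler_pdivrMr // mul1r => /(_ isT ab).
rewrite sqrtrM // -/a -/b bb {1}aa.
have -> // : a / b * b ^+ 2 + a ^+ 2 / (a / b) = 2 * (a * b).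
by field; rewrite !gt_eqF.
Qed.

(** With no reward function of means [q], the average is a division by zero, whose value is 0. Thus
    the success hypothesis itself supplies nonemptiness. *)
Lemma succ_prob_card N M T d (A : algorithm R N M d) (q : 'I_N -> R) (a : 'I_N) :
  0 < succ_prob T A q a -> (0 < #|rewards_with_means M q|)%N.
Proof.
rewrite lt0n /succ_prob; case: eqP => // ->.
by rewrite invr0 mulr0 ltxx.
Qed.

(** The arms partition the basis and each state has norm 1. *)
Lemma sum_avg_arms N M T d (A : algorithm R N M d) (q : 'I_N -> R)
    (t : nat) (P : pred 'I_N) :
  valid_algorithm T A -> (t <= T)%N -> (0 < #|rewards_with_means M q|)%N ->
  \sum_(k | P k) avg q (fun r => massOn (on_arm k) (state A r t)) <= 1.
Proof.
move=> vA tT Rq0; rewrite /avg -mulr_suml ler_pdivrMr ?ltr0n // mul1r.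
rewrite exchange_big -sum1_card natr_sum /=; apply: ler_sum => r _.
rewrite -(rdot_state r vA tT) -sum_massOn_arms [leRHS](bigID P) /= lerDl.
by apply: sumr_ge0 => k _; apply: massOn_ge0.
Qed.

Lemma sum_arms n (f : nat -> R) :
  \sum_(2 <= i < n.+2) f i = \sum_(k < n.+1 | k != ord0) f k.+1.
Proof.
by rewrite 2!big_add1 big_mkord [RHS]big_mkcond big_ord_recl /= add0r.
Qed.

Lemma Hcomp_max n (q : 'I_n -> R) (i : 'I_n) :
  (forall j, j != i -> q j < q i) -> Hcomp q = \sum_(j | j != i) (q i - q j)^-2.
Proof.
move=> qi; rewrite /Hcomp; case: pickP => [j /forallP h|/(_ i)/negP[]]; last first.
  by apply/forallP => j; apply/implyP/qi.
suff -> : j = i by [].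
apply/eqP; apply: contraT => ji; have := h i; rewrite eq_sym ji /= => qij.
by have := lt_trans (qi j ji) qij; rewrite ltxx.
Qed.

Lemma pvecS N (p : nat -> R) (k i : 'I_N) :
  pvec p k.+1 i = if i == k then p 0%N else p i.+1.
Proof. by rewrite /pvec eqSS eq_sym. Qed.

End Assembly.

Theorem theorem11 (R : realType) (eta delta : R) :
  0 < eta -> eta < 1 / 2 -> 0 <= delta -> delta < 1 / 2 ->
  exists2 c : R, 0 < c &
  forall (N M T d : nat) (p : nat -> R) (A : algorithm R N M d),
    (2 <= N)%N ->
    p 1%N < p 0%N -> p 2%N < p 1%N ->
    (forall i : nat, (2 <= i)%N -> (i < N)%N -> p i.+1 <= p i) ->
    (forall i : nat, (i <= N)%N -> eta <= p i <= 1 - eta) ->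
    p 0%N - p 1%N = p 1%N - p 2%N ->
    (0 < M)%N ->
    (forall i : nat, (i <= N)%N -> exists n : nat, M%:R * p i = n%:R) ->
    valid_algorithm T A ->
    (forall (k : nat) (a : 'I_N), (k <= N)%N ->
       (if k == 0%N then a == 0%N :> nat else (a.+1 == k)) ->
       1 - delta <= succ_prob T A ((@pvec R N p k)) a) ->
    let bound := 1 / 2 * eta * (1 - 2 * Num.sqrt (delta * (1 - delta))) *
                 Num.sqrt (\sum_(2 <= i < N.+1) (p 0%N - p i)^-2) in
    bound <= T%:R /\ c * Num.sqrt (Hcomp ((@pvec R N p 1))) <= bound.
Proof.
move=> eta0 eta1 delta0 delta1.
set gamma := 1 - 2 * Num.sqrt (delta * (1 - delta)).
have gamma0 : 0 < gamma.
  rewrite /gamma subr_gt0.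
  have h : Num.sqrt (delta * (1 - delta)) < Num.sqrt (2^-1 ^+ 2).
    rewrite ltr_sqrt ?exprn_gt0 ?invr_gt0 //.
    (* [1/4 - delta (1 - delta)] is this square. *)
    have : 0 < (2^-1 - delta) ^+ 2 by rewrite exprn_gt0 // subr_gt0; lra.
    rewrite !expr2; lra.
  by move: h; rewrite sqrtr_sqr ger0_norm //; lra.
exists (1 / 2 * eta * gamma); first by rewrite !mulr_gt0 ?invr_gt0.
case=> [|n] // M T d p A N2 p10 p21 pmono peta _ M0 pint vA succ /=.
have ple i : (2 <= i <= n.+1)%N -> p i <= p 2%N.
  elim: i => // i IHi /andP[]; rewrite leq_eqVlt => /orP[/eqP <- //|i2 iN].
  apply: le_trans (pmono i i2 iN) (IHi _).
  by apply/andP; split; last exact: ltnW.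
have pk0 (k : 'I_n.+1) : k != ord0 -> p k.+1 < p 0%N.
  move=> k0; apply: le_lt_trans (lt_trans p21 p10); apply: ple.
  by apply/andP; split; [rewrite ltnS lt0n | exact: ltn_ord].
set S := \sum_(2 <= i < n.+2) _.
have SE : S = \sum_(k < n.+1 | k != ord0) (p 0%N - p k.+1)^-2.
  exact: (sum_arms n (fun i => (p 0%N - p i)^-2)).
split; last first.
  have p1E (j : 'I_n.+1) : pvec p 1 j = if j == ord0 then p 0%N else p j.+1.
    exact: (pvecS p ord0 j).
  rewrite (@Hcomp_max _ _ _ ord0) => [|j j0]; last first.
    by rewrite !p1E eqxx (negPf j0) pk0.
  rewrite SE le_eqVlt; apply/orP; left; apply/eqP; congr (_ * Num.sqrt _).
  by apply: eq_bigr => j j0; rewrite !p1E eqxx (negPf j0).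
have S0 : 0 < S.
  have k1 : (1 < n.+1)%N by [].
  rewrite SE (bigD1 (Ordinal k1)) //= ltr_wpDr ?exprn_gt0 ?invr_gt0 //.
    by apply: sumr_ge0 => k _; rewrite invr_ge0 sqr_ge0.
  by rewrite exprn_gt0 // subr_gt0 (lt_trans p21).
pose s := Num.sqrt S; have s0 : 0 < s by rewrite sqrtr_gt0.
have ss : S = s ^+ 2 by rewrite sqr_sqrtr // ltW.
pose q := @pvec R n.+1 p 0%N.
pose m t k := avg q (fun r => massOn (on_arm k) (state A r t)).
have dpos : 0 < 1 - delta by lra.
have Rq0 : (0 < #|rewards_with_means M q|)%N.
  apply: (@succ_prob_card _ _ _ T _ A q ord0).
  by apply: lt_le_trans dpos (succ _ _ _ _).
(* Ordinal [k] is arm [k + 1]. Arm 1 is the right output for both [p^0] and [p^1], so only the other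
   arms give a pair of cases to tell apart. *)
have arm (k : 'I_n.+1) : k != ord0 ->
    gamma * (p 0%N - p k.+1)^-2 <=
    eta^-1 * \sum_(t < T) (s * m t k + (p 0%N - p k.+1)^-2 / s).
  move=> k0; set D := p 0%N - p k.+1.
  have D0 : 0 < D by rewrite subr_gt0 pk0.
  pose q' := @pvec R n.+1 p k.+1.
  have q'k : q' k = p 0%N by rewrite /q' pvecS eqxx.
  have kN : (k.+1 <= n.+1)%N by [].
  have sk : 1 - delta <= succ_prob T A q' k by apply: succ => //=.
  have sq : 1 - delta <= succ_prob T A q ord0 by apply: succ.
  have Rq'0 : (0 < #|rewards_with_means M q'|)%N.
    by apply: succ_prob_card (lt_le_trans dpos sk).
  have [n0 En0] := pint 0%N isT; have [nk Enk] := pint k.+1 kN.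
  have M0' : 0 < M%:R :> R by rewrite ltr0n.
  have nk_le : (nk <= n0)%N.
    by rewrite -(ler_nat R) -En0 -Enk ler_pM2l // ltW // pk0.
  have mE : (n0 - nk)%:R = M%:R * D by rewrite natrB // -En0 -Enk mulrBr.
  have /andP[pk_ge pk_le] := peta k.+1 kN.
  have /andP[p0_ge p0_le] := peta 0%N isT.
  have MD : 0 <= M%:R * D / eta by rewrite !mulr_ge0 ?invr_ge0 // ltW.
  (* Applied to [x = 1 - p k.+1] for the zeros under [q] and to [x = p 0] for the ones under
     [q']. *)
  have bound_m x : eta <= x -> (n0 - nk)%:R <= D / eta * (M%:R * x).
    move=> ex; rewrite mE.
    have -> : M%:R * D = M%:R * D / eta * eta by field; rewrite gt_eqF.
    have -> : D / eta * (M%:R * x) = M%:R * D / eta * x by ring.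
    by rewrite ler_wpM2l.
  have key : 1 - D / eta * \sum_(t < T) (D * s * m t k + (D * s)^-1) <=
      2 * Num.sqrt (delta * (1 - delta)).
    apply: le_2sqrt_of_forall => // mu mu0 mu1.
    have := @arm_bound R n.+1 M d T A q q' k ord0 (n0 - nk) (D / eta) (D * s) mu
      vA _ M0 _ _ Rq0 Rq'0 _ _ _ _ _ _ mu0 mu1.
    rewrite q'k /q /pvec /= -/q mulr_gt0 // eq_sym k0.
    have qE i : i != k -> q' i = p i.+1.
      by move=> ik; rewrite /q' pvecS (negPf ik).
    move/(_ isT qE).
    have E1 : M%:R * p 0%N = M%:R * p k.+1 + (n0 - nk)%:R by rewrite mE /D; ring.
    have h1 : p 0%N <= 1 by lra.
    have h2 : p k.+1 < 1 by lra.
    have h3 : 0 < p 0%N by lra.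
    have h4 : eta <= 1 - p k.+1 by lra.
    move/(_ E1 h1 h2 h3 (bound_m _ h4) (bound_m _ p0_ge) isT).
    have imu : mu - mu^-1 <= 0 by rewrite subr_le0 (le_trans mu1) // invf_ge1.
    (* As [mu - mu^-1 <= 0], lower bounds on the success probabilities give an upper bound, and the
       measurement term becomes [mu (1 - delta) + delta / mu]. *)
    have : (mu - mu^-1) * (succ_prob T A q ord0 + succ_prob T A q' k - 1) <=
        (mu - mu^-1) * (1 - 2 * delta) by rewrite ler_wnM2l //; lra.
    rewrite !mulrBl /m; lra.
  have {}key : gamma <= D / eta * \sum_(t < T) (D * s * m t k + (D * s)^-1).
    by rewrite /gamma; lra.
  (* The weight [D^-2] makes the coefficient of [m t k] the same for all arms. *)
  have -> : eta^-1 * \sum_(t < T) (s * m t k + D^-2 / s) =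
      D / eta * (\sum_(t < T) (D * s * m t k + (D * s)^-1)) * D^-2.
    rewrite !mulr_sumr mulr_suml; apply: eq_bigr => t _.
    by field; rewrite !gt_eqF.
  by rewrite ler_wpM2r // invr_ge0 sqr_ge0.
have main : gamma * S <= eta^-1 * (T%:R * (2 * s)).
  apply: le_trans (_ : eta^-1 * \sum_(t < T)
      (s * (\sum_(k < n.+1 | k != ord0) m t k) + S / s) <= _).
    have -> : eta^-1 * \sum_(t < T)
        (s * (\sum_(k < n.+1 | k != ord0) m t k) + S / s) =
      \sum_(k < n.+1 | k != ord0) eta^-1 *
        \sum_(t < T) (s * m t k + (p 0%N - p k.+1)^-2 / s).
      rewrite -mulr_sumr exchange_big /=; congr (_ * _); apply: eq_bigr => t _.
      by rewrite big_split /= mulr_sumr SE mulr_suml.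
    by rewrite SE mulr_sumr; apply: ler_sum => k /arm.
  rewrite ler_wpM2l ?invr_ge0 ?(ltW eta0) //.
  rewrite -[X in X%:R](card_ord T) mulr_natl -sumr_const; apply: ler_sum => t _.
  (* Each call contributes at most [s] from the weights and [S / s = s] from the constant terms. *)
  have := sum_avg_arms (fun k => k != ord0) vA (ltnW (ltn_ord t)) Rq0.
  rewrite -/(m t _) => /(ler_wpM2l (ltW s0)).
  have -> : S / s = s by rewrite ss; field; rewrite gt_eqF.
  rewrite /m; lra.
rewrite -/s -(ler_pM2r (_ : 0 < 2 * s / eta)); last by rewrite !mulr_gt0 ?invr_gt0.
have -> : 1 / 2 * eta * gamma * s * (2 * s / eta) = gamma * S.
  by rewrite ss; field; rewrite gt_eqF.
by have -> : T%:R * (2 * s / eta) = eta^-1 * (T%:R * (2 * s)) by ring.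
Qed.
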